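(* Let $c>0$ and let $x_1,\dots,x_7\in\mathbb{R}^3$ be seven distinct observation points such that $x_1,x_2,x_3$ lie on a line $l_1$, $x_1,x_4,x_5$ lie on a line $l_2$, and $x_1,x_6,x_7$ lie on a line $l_3$, where $l_1,l_2,l_3$ are pairwise perpendicular and $x_6,x_7$ are symmetric with respect to $x_1$ (so $|x_1-x_6|=|x_1-x_7|$). Let $a:[t_{\min},t_{\max}]\to\mathbb{R}^3$ be a subsonic source trajectory with emission moments $t_1<\dots<t_J$ and times of arrival $T_{jk}=t_j+c^{-1}|x_k-a(t_j)|$, as described in the context. Then for each $j\in\{1,\dots,J\}$ the source location $a(t_j)$ and the emission moment $t_j$ are uniquely determined by the times of arrival $T_{jk}$, $k=1,\dots,7$; that is, if $(y,s)\in\mathbb{R}^3\times\mathbb{R}$ satisfies $T_{jk}=s+c^{-1}|x_k-y|$ for all $k=1,\dots,7$, then $y=a(t_j)$ and $s=t_j$.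
   Context: Setting: $c>0$ is the constant wave speed in $\mathbb{R}^3$ and $|\cdot|$ is the Euclidean norm. A moving point source follows a continuous trajectory $a:[t_{\min},t_{\max}]\to\mathbb{R}^3$, $0<t_{\min}<t_{\max}$, with $|a'(t)|<c$ for all $t\in[t_{\min},t_{\max}]$. It emits pulses at the emission moments $t_{\min}\le t_1<\dots<t_J\le t_{\max}$. The image of the trajectory is $\Gamma=\{a(t):t\in[t_{\min},t_{\max}]\}$, and the observation points satisfy $x_k\notin\Gamma$. The time of arrival of the $j$-th pulse at $x_k$ is $T_{jk}=t_j+c^{-1}|x_k-a(t_j)|$. The observation points and $c$ are known; $a(t_j)$ and $t_j$ are unknown. *)

(* Defs.v *)
From HB Require Import structures.
From mathcomp Require Import all_boot all_order all_algebra.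
From mathcomp Require Import all_classical all_reals all_analysis.

Set Implicit Arguments.
Unset Strict Implicit.
Unset Printing Implicit Defensive.

Import Order.TTheory GRing.Theory Num.Theory.
Import numFieldNormedType.Exports.

Local Open Scope classical_set_scope.
Local Open Scope ring_scope.

Definition dotp (R : realType) (u v : 'rV[R]_3) : R :=
  \sum_(i < 3) u 0 i * v 0 i.

(* The norm `|u| of MathComp-Analysis on row vectors is the sup norm, hence
   this separate Euclidean norm. Both induce the same topology, so limits in
   'rV[R]_3 below are the usual ones. *)
Definition enorm (R : realType) (u : 'rV[R]_3) : R := Num.sqrt (dotp u u).

Definition line (R : realType) (p d : 'rV[R]_3) : set 'rV[R]_3 :=
  [set q | exists s : R, q = p + s *: d].

(* Only the directions are compared: the perpendicular lines of the theorem
   meet because they have a common point by hypothesis. *)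
Definition perp_lines (R : realType) (l m : set 'rV[R]_3) : Prop :=
  exists p d q e : 'rV[R]_3,
    [/\ d != 0, e != 0, l = line p d, m = line q e & dotp d e = 0].

(* The derivative of a at t relative to D, so one-sided when D is a closed
   interval and t one of its endpoints: values of a outside D play no role. *)
Definition has_velocity (R : realType) (D : set R) (a : R -> 'rV[R]_3)
    (t : R) (v : 'rV[R]_3) : Prop :=
  (fun s => (s - t)^-1 *: (a s - a t)) @ within D t^' --> v.

Definition subsonic_trajectory (R : realType) (c tmin tmax : R)
    (a : R -> 'rV[R]_3) : Prop :=
  {within `[tmin, tmax], continuous a} /\
  forall t, t \in `[tmin, tmax] ->
    exists2 v, has_velocity `[tmin, tmax] a t v & enorm v < c.

(* Main.v *)
Require Import Defs.
From HB Require Import structures.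
From mathcomp Require Import all_boot all_order all_algebra.
From mathcomp Require Import all_classical all_reals all_analysis.
From mathcomp Require Import ring lra.
Import Order.TTheory GRing.Theory Num.Theory.
Import numFieldNormedType.Exports.
Local Open Scope classical_set_scope.
Local Open Scope ring_scope.

(** Put the origin at [x1], write [p] for the true source and [y] for a second
    candidate, and let [h] be the common shift [c * (t_j - s)] of all distances:
    [|x_k - y| = |x_k - p| + h] for every receiver.  Squaring, and subtracting
    the same relation at the origin, leaves a relation linear in [x_k]:
    [h * (|x_k - p| - |p|) = x_k . (p - y)] ([range_shift_identity]).

    Suppose [h != 0].  Then along a line through the origin the distance to [p]
    is an affine function of the position at three points (the origin and the
    two other receivers).  The squared distance is a quadratic polynomial in
    the position, so agreeing with the square of an affine function at three
    points makes it a perfect square: its discriminant vanishes, which is the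
    equality case of Cauchy-Schwarz between [p] and the line
    ([collinear_ranges_cauchy_eq]).  So [p] lies on [l1] and on [l2]; these are
    perpendicular and meet only at the origin ([cauchy_eq_perp_eq0]), so
    [p = x1], which is excluded because the trajectory avoids the receivers.

    Hence [h = 0], and then [p - y] is orthogonal to one nonzero vector on each
    of three pairwise perpendicular lines, so [p = y]
    ([orthogonal_triple_total]); equality of the emission moments follows. *)

Section EuclideanSpace.

Context {R : realType}.
Implicit Types u v w p q y z : 'rV[R]_3.

Lemma dotpC u v : dotp u v = dotp v u.
Proof. by apply: eq_bigr => i _; rewrite mulrC. Qed.

Lemma dotpDl u v w : dotp (u + v) w = dotp u w + dotp v w.
Proof. by rewrite -big_split; apply: eq_bigr => i _; rewrite mxE mulrDl. Qed.

Lemma dotpZl (k : R) u v : dotp (k *: u) v = k * dotp u v.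
Proof. by rewrite /dotp mulr_sumr; apply: eq_bigr => i _; rewrite mxE mulrA. Qed.

Lemma dotpNl u v : dotp (- u) v = - dotp u v.
Proof. by rewrite -scaleN1r dotpZl mulN1r. Qed.

Lemma dotpDr u v w : dotp u (v + w) = dotp u v + dotp u w.
Proof. by rewrite !(dotpC u) dotpDl. Qed.

Lemma dotpZr (k : R) u v : dotp u (k *: v) = k * dotp u v.
Proof. by rewrite !(dotpC u) dotpZl. Qed.

Lemma dotpNr u v : dotp u (- v) = - dotp u v.
Proof. by rewrite !(dotpC u) dotpNl. Qed.

Lemma dotp0r u : dotp u 0 = 0.
Proof. by rewrite -(scale0r u) dotpZr mul0r. Qed.

Definition dotpE := (dotpDl, dotpDr, dotpNl, dotpNr, dotpZl, dotpZr).

Lemma dotp_ge0 u : 0 <= dotp u u.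
Proof. by apply: sumr_ge0 => i _; rewrite -expr2 sqr_ge0. Qed.

Lemma dotp_eq0 u : (dotp u u == 0) = (u == 0).
Proof.
apply/eqP/eqP => [u0|->]; last exact: dotp0r.
have sq_ge0 (i : 'I_3) : true -> 0 <= u 0 i * u 0 i.
  by rewrite -expr2 sqr_ge0.
have /allP/= all0 : all (fun i : 'I_3 => true ==> (u 0 i * u 0 i == 0))
    (index_enum 'I_3).
  by rewrite -psumr_eq0 //; apply/eqP.
apply/rowP => i; rewrite mxE; apply/eqP.
by have := all0 i (mem_index_enum i); rewrite mulf_eq0 orbb.
Qed.

Lemma sqr_enorm u : enorm u ^+ 2 = dotp u u.
Proof. by rewrite sqr_sqrtr ?dotp_ge0. Qed.

Lemma enorm_distC u v : enorm (u - v) = enorm (v - u).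
Proof. by rewrite /enorm -opprB dotpNl dotpNr opprK. Qed.

(** Orthogonal nonzero rows make a Gram matrix that is diagonal with nonzero
    entries, so the matrix of these rows is invertible. *)
Lemma orthogonal_triple_total (e : 'I_3 -> 'rV[R]_3) z :
  (forall i, e i != 0) -> (forall i j, i != j -> dotp (e i) (e j) = 0) ->
  (forall i, dotp (e i) z = 0) -> z = 0.
Proof.
move=> e_neq0 e_orth z_orth.
pose M : 'M[R]_3 := \matrix_(i, j) e i 0 j.
have gramE : M *m M^T = diag_mx (\row_i dotp (e i) (e i)).
  apply/matrixP => i j; rewrite !mxE.
  have -> : \sum_k M i k * M^T k j = dotp (e i) (e j).
    by apply: eq_bigr => k _; rewrite !mxE.
  by have [<-|/e_orth ->] := eqVneq i j; rewrite ?mulr1n ?mulr0n.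
have /mulmx1_unit[_ MTunit] :
    (invmx (M *m M^T) *m M) *m M^T = 1%:M.
  rewrite -mulmxA mulVmx // gramE unitmxE det_diag unitfE prodf_seq_neq0.
  by apply/allP => i _ /=; rewrite mxE dotp_eq0.
rewrite -[z](mulmxK MTunit).
suff -> : z *m M^T = 0 by rewrite mul0mx.
apply/rowP => i; rewrite !mxE -[RHS](z_orth i) dotpC.
by apply: eq_bigr => k _; rewrite !mxE.
Qed.

(** Equality in Cauchy-Schwarz puts [p] on the line spanned by [u] and on the
    line spanned by [v]; perpendicular lines meet only at the origin. *)
Lemma cauchy_eq_perp_eq0 u v p : u != 0 -> v != 0 -> dotp u v = 0 ->
  dotp u p ^+ 2 = dotp u u * dotp p p ->
  dotp v p ^+ 2 = dotp v v * dotp p p -> p = 0.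
Proof.
move=> u0 v0 uv pu pv.
have onu : dotp u u *: p - dotp u p *: u = 0.
  by apply/eqP; rewrite -dotp_eq0 !dotpE (dotpC p u); apply/eqP; ring: pu.
have := congr1 (dotp v) onu.
rewrite !dotpE (dotpC v u) uv mulr0 oppr0 addr0.
rewrite dotp0r => /eqP; rewrite mulf_eq0 dotp_eq0 (negPf u0) /= => /eqP vp0.
move: pv; rewrite vp0 expr0n => /esym/eqP.
by rewrite mulf_eq0 !dotp_eq0 (negPf v0) /= => /eqP.
Qed.

(** The terms quadratic in [u] cancel because both squared distances contain
    the same [dotp u u]. *)
Lemma range_shift_identity u p y (h : R) :
  enorm y = enorm p + h -> enorm (u - y) = enorm (u - p) + h ->
  h * (enorm (u - p) - enorm p) = dotp u (p - y).
Proof.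
move=> h0 hu.
have := sqr_enorm y; have := sqr_enorm (u - y).
have := sqr_enorm p; have := sqr_enorm (u - p).
rewrite h0 hu !dotpE (dotpC p u) (dotpC y u) => E1 E2 E3 E4.
lra.
Qed.

(** The squared distance from [p] to [s *: u] is the square of an affine
    function of [s] at [s = 0], [1] and [l], hence at every [s]. *)
Lemma collinear_ranges_cauchy_eq u p y (h l : R) :
  h != 0 -> l != 0 -> l != 1 ->
  enorm y = enorm p + h ->
  enorm (u - y) = enorm (u - p) + h ->
  enorm (l *: u - y) = enorm (l *: u - p) + h ->
  dotp u p ^+ 2 = dotp u u * dotp p p.
Proof.
move=> h0 l0 l1 hp hu hlu.
(* the slope of the affine function *)
pose m := dotp u (p - y) / h.
have Du : enorm (u - p) = enorm p + m.
  rewrite /m -(range_shift_identity _ _ _ _ hp hu); field; exact: h0.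
have Dlu : enorm (l *: u - p) = enorm p + l * m.
  have := range_shift_identity _ _ _ _ hp hlu.
  rewrite dotpZl => E; rewrite /m mulrA -E; field; exact: h0.
have := sqr_enorm (u - p); have := sqr_enorm (l *: u - p).
have Ep := sqr_enorm p.
rewrite Du Dlu !dotpE (dotpC p u) => E2 E1.
have l1' : l - 1 != 0 by rewrite subr_eq0.
have um : dotp u u = m ^+ 2.
  apply: (mulfI l0); apply: (mulfI l1').
  by move: (congr1 ( *%R l) E1) (congr1 ( *%R l) Ep) => /= *; lra.
have up : dotp u p = - (enorm p * m) by lra.
by rewrite up um -Ep; ring.
Qed.

(** Taking [b - a] as the direction of the line puts its three points at the
    parameters [0], [1] and [l] of [collinear_ranges_cauchy_eq]; that they are
    distinct is what makes [l] differ from [0] and [1]. *)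
Lemma line_ratio (L : set 'rV[R]_3) a b q d o :
  L = line o d -> L a -> L b -> L q -> a != b -> b != q -> a != q ->
  exists l : R, [/\ l != 0, l != 1 & q - a = l *: (b - a)].
Proof.
move=> -> [s ->] [s' ->] [s'' ->] ab bq aq.
have s's : s' - s != 0 by apply: contraNneq ab => /subr0_eq ->.
have s''s : s'' - s != 0 by apply: contraNneq aq => /subr0_eq ->.
exists ((s'' - s) / (s' - s)); split.
- by rewrite mulf_neq0 ?invr_eq0.
- by apply: contraNneq bq => /divr1_eq/addIr ->.
- have diff r1 r2 : o + r1 *: d - (o + r2 *: d) = (r1 - r2) *: d.
    by rewrite opprD addrACA subrr add0r scalerBl.
  by rewrite !diff scalerA; congr (_ *: _); field.
Qed.

Lemma perp_lines_dotp (l m : set 'rV[R]_3) a b p q :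
  perp_lines l m -> l a -> l b -> m p -> m q -> dotp (b - a) (q - p) = 0.
Proof.
case=> [x0 [d [y0 [e [_ _ -> -> de]]]]] [s ->] [s' ->] [r ->] [r' ->].
by rewrite !dotpE de; ring: de.
Qed.

End EuclideanSpace.

Theorem theorem2p3 (R : realType) (c : R) (hc : 0 < c)
  (* observation points *)
  (x1 x2 x3 x4 x5 x6 x7 : 'rV[R]_3) (x : 7.-tuple 'rV[R]_3)
  (hx : x = [tuple x1; x2; x3; x4; x5; x6; x7])
  (hdistinct : uniq x)
  (l1 l2 l3 : set 'rV[R]_3)
  (hl1 : [/\ l1 x1, l1 x2 & l1 x3])
  (hl2 : [/\ l2 x1, l2 x4 & l2 x5])
  (hl3 : [/\ l3 x1, l3 x6 & l3 x7])
  (hperp : [/\ perp_lines l1 l2, perp_lines l1 l3 & perp_lines l2 l3])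
  (hsym : x7 - x1 = - (x6 - x1))
  (* source *)
  (tmin tmax : R) (htmin : 0 < tmin) (htminmax : tmin < tmax)
  (a : R -> 'rV[R]_3) (ha : subsonic_trajectory c tmin tmax a)
  (hGamma : forall k : 'I_7, ~ (a @` `[tmin, tmax]) (tnth x k))
  (* emission moments and times of arrival *)
  (J : nat) (t : 'I_J -> R)
  (ht : forall j, tmin <= t j <= tmax)
  (htlt : forall i j : 'I_J, (i < j)%N -> t i < t j)
  (T : 'I_J -> 'I_7 -> R)
  (hT : forall j k, T j k = t j + c^-1 * enorm (tnth x k - a (t j))) :
  forall (j : 'I_J) (y : 'rV[R]_3) (s : R),
    (forall k, T j k = s + c^-1 * enorm (tnth x k - y)) ->
    y = a (t j) /\ s = t j.
Proof.
move=> j y s Tj.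
pose h := c * (t j - s); pose p := a (t j) - x1.
have shift k : enorm (tnth x k - y) = enorm (tnth x k - a (t j)) + h.
  have c0 := lt0r_neq0 hc; have := Tj k; rewrite hT => E.
  apply: (mulfI (invr_neq0 c0)); rewrite mulrDr /h mulKf //; lra.
have shift1 : enorm (y - x1) = enorm p + h.
  have := shift ord0; rewrite hx (tnth_nth 0) /= enorm_distC => ->.
  by rewrite enorm_distC.
have shiftk k : enorm (tnth x k - x1 - (y - x1)) =
    enorm (tnth x k - x1 - p) + h.
  by rewrite /p !opprB !addrA !subrK shift.
have sh2 := shiftk (inord 1); have sh3 := shiftk (inord 2).
have sh4 := shiftk (inord 3); have sh5 := shiftk (inord 4).
have sh6 := shiftk (inord 5).
rewrite hx !(tnth_nth 0) !inordK //= in sh2 sh3 sh4 sh5 sh6.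
have neq (i k : nat) : (i < k < 7)%N -> nth 0 x i != nth 0 x k.
  case/andP=> ik k7; rewrite nth_uniq ?size_tuple ?(ltn_trans ik) //.
  by rewrite ltn_eqF.
have n12 := neq 0%N 1%N isT; have n13 := neq 0%N 2%N isT.
have n23 := neq 1%N 2%N isT; have n14 := neq 0%N 3%N isT.
have n15 := neq 0%N 4%N isT; have n45 := neq 3%N 4%N isT.
have n16 := neq 0%N 5%N isT.
rewrite hx /= in n12 n13 n23 n14 n15 n45 n16.
have [l11 l12 l13] := hl1; have [l21 l24 l25] := hl2.
have [l31 l36 _] := hl3; have [perp12 perp13 perp23] := hperp.
have uv := perp_lines_dotp _ _ _ _ _ _ perp12 l11 l12 l21 l24.
have uw := perp_lines_dotp _ _ _ _ _ _ perp13 l11 l12 l31 l36.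
have vw := perp_lines_dotp _ _ _ _ _ _ perp23 l21 l24 l31 l36.
have u0 : x2 - x1 != 0 by rewrite subr_eq0 eq_sym.
have v0 : x4 - x1 != 0 by rewrite subr_eq0 eq_sym.
have w0 : x6 - x1 != 0 by rewrite subr_eq0 eq_sym.
have h0 : h = 0.
  have [//|h_neq0] := eqVneq h 0.
  have [z1 [d1 [z2 [d2 [_ _ l1E l2E _]]]]] := perp12.
  have [r1 [r1_0 r1_1 x3E]] :=
    line_ratio _ _ _ _ _ _ l1E l11 l12 l13 n12 n23 n13.
  have [r2 [r2_0 r2_1 x5E]] :=
    line_ratio _ _ _ _ _ _ l2E l21 l24 l25 n14 n45 n15.
  rewrite x3E in sh3; rewrite x5E in sh5.
  have p0 := cauchy_eq_perp_eq0 _ _ _ u0 v0 uv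
    (collinear_ranges_cauchy_eq _ _ _ _ _ h_neq0 r1_0 r1_1 shift1 sh2 sh3)
    (collinear_ranges_cauchy_eq _ _ _ _ _ h_neq0 r2_0 r2_1 shift1 sh4 sh5).
  (* the source would sit at the receiver [x1] *)
  case: (hGamma ord0); exists (t j); first by rewrite /= in_itv /= ht.
  by rewrite hx (tnth_nth 0) /=; apply/eqP; rewrite -subr_eq0; apply/eqP.
have /subr0_eq/addIr ya : p - (y - x1) = 0.
  pose e (i : 'I_3) := nth 0 [:: x2 - x1; x4 - x1; x6 - x1] i.
  apply: (@orthogonal_triple_total _ e).
  - by case=> [[|[|[|?]]] ?].
  - by case=> [[|[|[|?]]] ?] [[|[|[|?]]] ?] //= _; rewrite // dotpC.
  - case=> [[|[|[|//]]] ?] /=.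
    + by rewrite -(range_shift_identity _ _ _ _ shift1 sh2) h0 mul0r.
    + by rewrite -(range_shift_identity _ _ _ _ shift1 sh4) h0 mul0r.
    + by rewrite -(range_shift_identity _ _ _ _ shift1 sh6) h0 mul0r.
split; first by [].
apply/eqP; rewrite eq_sym -subr_eq0.
by move/eqP: h0; rewrite mulf_eq0 (negPf (lt0r_neq0 hc)).
Qed.
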